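(* Let $k,m,n,l\ge1$, let $\mu$ be a measure on $[k]$, and for $1\le i\le n$ let $a^i_1,\dots,a^i_m\subseteq[k]$. Then $$p_l\Big(\bigcup_{i=1}^n\{a^i_1,\dots,a^i_m\}\Big)=\frac{1}{(m!)^{n-1}}\sum_{\sigma\in\{\mathrm{id}\}\times S_m^{n-1}}\ \sum_{j=1}^{m}\ \sum_{(c_I)}\binom{l}{(c_I)}\prod_{\emptyset\ne I\subseteq[n]}(-1)^{(|I|+1)c_I}\,\mu\Big(\bigcap_{i\in I}a^i_{\sigma_i(j)}\Big)^{c_I},$$ where $\sigma=(\sigma_1,\dots,\sigma_n)$ with $\sigma_1=\mathrm{id}$, the inner sum runs over families $(c_I)_{\emptyset\ne I\subseteq[n]}$ of nonnegative integers with $\sum_I c_I=l$, and $\binom{l}{(c_I)}=l!/\prod_I c_I!$ is the multinomial coefficient.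
   Context: Work over $\mathbb{R}$. $[k]=\{1,\dots,k\}$; $\langle P[k]\rangle$ is the real vector space with basis the subsets of $[k]$, with union the bilinear extension of set union; $\langle P[k]\rangle^{\otimes m}$ has componentwise union and $S_m$ permutes tensor factors. $\mathrm{Sym}^m\langle P[k]\rangle=\langle P[k]\rangle^{\otimes m}/S_m$ (coinvariants), $\{a_1,\dots,a_m\}$ denotes the class of $a_1\otimes\cdots\otimes a_m$, union on it is $\bar u\cup\bar v=\frac{1}{m!}\sum_{\tau\in S_m}\overline{u\cup\tau v}$, and $\bigcup_{i=1}^n$ is the iterated union. A measure on $[k]$ is a map $\mu:P([k])\to\mathbb{R}$ with $\mu(a\cup b)=\mu(a)+\mu(b)$ for disjoint $a,b$. The power function $p_l:\mathrm{Sym}^m\langle P[k]\rangle\to\mathbb{R}$ is the linear map with $p_l(\{a_1,\dots,a_m\})=\sum_{i=1}^m\mu(a_i)^l$. *)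

(* Defs.v *)
From HB Require Import structures.
From mathcomp Require Import all_boot all_order all_algebra all_fingroup.
From mathcomp Require Import generic_quotient ring_quotient.
From mathcomp Require Import reals.

Set Implicit Arguments.
Unset Strict Implicit.
Unset Printing Implicit Defensive.

Import GRing.Theory Num.Theory.

Local Open Scope ring_scope.
Local Open Scope quotient_scope.

Definition is_measure (R : realType) (k : nat) (mu : {set 'I_k} -> R) : Prop :=
  forall A B : {set 'I_k}, [disjoint A & B] -> mu (A :|: B) = mu A + mu B.

Notation neset n := {I : {set 'I_n} | I != set0}.

(* <P[k]>, a vector being given by its coordinates in the basis of subsets. *)
Notation freeP R k := {ffun {set 'I_k} -> R^o}.

(* The m-th tensor power of <P[k]>, given by coordinates in the basis of the
   tensors A_1 (x) ... (x) A_m with A_j subsets of [k]. *)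
Notation tpow R k m := {ffun {ffun 'I_m -> {set 'I_k}} -> R^o}.

Section Tensors.
Variables (R : realType) (k m : nat).
Local Notation V := (freeP R k).
Local Notation T := (tpow R k m).
Local Notation idx := {ffun 'I_m -> {set 'I_k}}.
Implicit Types (f g h : idx) (u v w : T) (s t : 'S_m).

Definition bset (A : {set 'I_k}) : V := [ffun B => (B == A)%:R].

Definition vcup (x y : V) : V :=
  \sum_A \sum_B (x A * y B) *: bset (A :|: B).

Definition tens (a : 'I_m -> V) : T := [ffun f : idx => \prod_j a j (f j)].

Definition tcup u v : T :=
  \sum_f \sum_g (u f * v g) *: tens (fun j => bset (f j :|: g j)).

(* s maps a_1 (x) ... (x) a_m to the tensor whose j-th factor is
   a_(s^-1 j); see tact_tens. *)
Definition tact s u : T := [ffun f : idx => u [ffun j => f (s j)]].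

Lemma tens_bset (a : 'I_m -> {set 'I_k}) :
  tens (fun j => bset (a j)) = [ffun f : idx => (f == finfun a)%:R].
Proof.
apply/ffunP=> f; rewrite !ffunE; case: eqP => [->|ne].
  by rewrite big1 // => j _; rewrite !ffunE eqxx.
have /existsP[j nj] : [exists j, f j != a j].
  rewrite -negb_forall; apply/negP => /forallP e; apply: ne.
  by apply/ffunP => j; rewrite ffunE; exact/eqP/e.
by rewrite (bigD1 j) //= ffunE (negbTE nj) mul0r.
Qed.

Definition tbas f : T := tens (fun j => bset (f j)).

Lemma tbasE f : tbas f = [ffun g : idx => (g == f)%:R].
Proof.
rewrite /tbas tens_bset; apply/ffunP => g; rewrite !ffunE.
by congr ((_ == _)%:R); apply/ffunP => j; rewrite ffunE.
Qed.

Lemma tbas_val f g : tbas f g = (g == f)%:R.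
Proof. by rewrite tbasE ffunE. Qed.

Lemma tens_eq (a b : 'I_m -> V) : a =1 b -> tens a = tens b.
Proof.
by move=> e; apply/ffunP => f; rewrite !ffunE; apply: eq_bigr => j _; rewrite e.
Qed.

Lemma tpow_decomp u : u = \sum_f u f *: tbas f.
Proof.
apply/ffunP => g; rewrite sum_ffunE (bigD1 g) //= big1 => [|f nf].
  by rewrite addr0 tbasE !ffunE eqxx /GRing.scale /= mulr1.
by rewrite tbasE !ffunE eq_sym (negbTE nf) scaler0.
Qed.

Lemma tact_is_linear s : linear (tact s).
Proof. by move=> c u v; apply/ffunP => f; rewrite !ffunE. Qed.
HB.instance Definition _ s :=
  GRing.isLinear.Build R T T *:%R (tact s) (tact_is_linear s).

Lemma tact_tens s (a : 'I_m -> V) :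
  tact s (tens a) = tens (fun j => a (s^-1%g j)).
Proof.
apply/ffunP => f; rewrite !ffunE (reindex_inj (@perm_inj _ s^-1%g)) /=.
by apply: eq_bigr => j _; rewrite ffunE permKV.
Qed.

Lemma tact_tact s t u : tact s (tact t u) = tact (t * s)%g u.
Proof.
apply/ffunP => f; rewrite !ffunE; congr (u _).
by apply/ffunP => j; rewrite !ffunE permM.
Qed.

Lemma tcupE u v :
  tcup u v = \sum_f \sum_g (u f * v g) *: tbas [ffun j => f j :|: g j].
Proof.
apply: eq_bigr => f _; apply: eq_bigr => g _; congr (_ *: _).
by apply: tens_eq => j; rewrite ffunE.
Qed.

Lemma tcup_linearl v : linear (tcup^~ v).
Proof.
move=> c u u'; rewrite /tcup scaler_sumr -big_split /=; apply: eq_bigr => f _.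
rewrite scaler_sumr -big_split /=; apply: eq_bigr => g _.
by rewrite !ffunE scalerA -scalerDl mulrA -mulrDl.
Qed.

Lemma tcup_linearr u : linear (tcup u).
Proof.
move=> c v v'; rewrite /tcup scaler_sumr -big_split /=; apply: eq_bigr => f _.
rewrite scaler_sumr -big_split /=; apply: eq_bigr => g _.
rewrite !ffunE scalerA -scalerDl; congr (_ *: _).
by rewrite mulrDr [u f * (_ *: _)]mulrCA.
Qed.
HB.instance Definition _ u :=
  GRing.isLinear.Build R T T *:%R (tcup u) (tcup_linearr u).

Lemma tcup_tens (a b : 'I_m -> V) :
  tcup (tens a) (tens b) = tens (fun j => vcup (a j) (b j)).
Proof.
apply/ffunP => h; rewrite ffunE.
have vcupE (x y : V) (C : {set 'I_k}) :
    vcup x y C = \sum_A \sum_B x A * y B * (C == A :|: B)%:R.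
  rewrite sum_ffunE; apply: eq_bigr => A _; rewrite sum_ffunE.
  by apply: eq_bigr => B _; rewrite !ffunE.
under [RHS]eq_bigr do rewrite vcupE.
rewrite bigA_distr_bigA sum_ffunE; apply: eq_bigr => f _.
rewrite bigA_distr_bigA sum_ffunE; apply: eq_bigr => g _.
rewrite !ffunE /GRing.scale /= -!big_split /=.
by apply: eq_bigr => j _; rewrite ffunE.
Qed.

Lemma tcup_bas f g : tcup (tbas f) (tbas g) = tbas [ffun j => f j :|: g j].
Proof.
rewrite tcupE (bigD1 f) //= [X in _ + X]big1 => [|f' nf]; last first.
  by rewrite big1 // => g' _; rewrite tbas_val (negbTE nf) mul0r scale0r.
rewrite addr0 (bigD1 g) //= [X in _ + X]big1 => [|g' ng]; last first.
  by rewrite [tbas g g']tbas_val (negbTE ng) mulr0 scale0r.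
by rewrite addr0 !tbas_val !eqxx mulr1 scale1r.
Qed.

Lemma tact_bas s f : tact s (tbas f) = tbas [ffun j => f (s^-1%g j)].
Proof. by rewrite tact_tens; apply: tens_eq => j; rewrite ffunE. Qed.

Lemma tcup_suml (I : finType) (c : I -> R) (F : I -> T) v :
  tcup (\sum_i c i *: F i) v = \sum_i c i *: tcup (F i) v.
Proof.
pose L := GRing.isLinear.Build R T T *:%R (tcup^~ v) (tcup_linearl v).
pose g : {linear T -> T} := HB.pack (tcup^~ v) L.
rewrite -[LHS]/(g _) linear_sum; apply: eq_bigr => i _; exact: linearZ.
Qed.

Lemma tcup_sumr (I : finType) (c : I -> R) (F : I -> T) u :
  tcup u (\sum_i c i *: F i) = \sum_i c i *: tcup u (F i).
Proof. by rewrite linear_sum; apply: eq_bigr => i _; rewrite linearZ. Qed.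

Lemma tact_sum (I : finType) (c : I -> R) (F : I -> T) s :
  tact s (\sum_i c i *: F i) = \sum_i c i *: tact s (F i).
Proof. by rewrite linear_sum; apply: eq_bigr => i _; rewrite linearZ. Qed.

Lemma tcupC u v : tcup u v = tcup v u.
Proof.
rewrite !tcupE exchange_big; apply: eq_bigr => f _; apply: eq_bigr => g _.
by rewrite mulrC; congr (_ *: tbas _); apply/ffunP => j; rewrite !ffunE setUC.
Qed.

Lemma tcupA u v w : tcup u (tcup v w) = tcup (tcup u v) w.
Proof.
rewrite (tpow_decomp u) !tcup_suml; apply: eq_bigr => f _; congr (_ *: _).
rewrite (tpow_decomp v) tcup_suml !tcup_sumr tcup_suml.
apply: eq_bigr => g _; congr (_ *: _).
rewrite (tpow_decomp w) !tcup_sumr; apply: eq_bigr => h _; congr (_ *: _).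
rewrite !tcup_bas; congr tbas; apply/ffunP => j; rewrite !ffunE; exact: setUA.
Qed.

Lemma tact_cup s u v : tact s (tcup u v) = tcup (tact s u) (tact s v).
Proof.
rewrite (tpow_decomp u) tact_sum !tcup_suml tact_sum.
apply: eq_bigr => f _; congr (_ *: _).
rewrite (tpow_decomp v) tact_sum !tcup_sumr tact_sum.
apply: eq_bigr => g _; congr (_ *: _).
rewrite tcup_bas !tact_bas tcup_bas; congr tbas.
by apply/ffunP => j; rewrite !ffunE.
Qed.

(* The span of all s u - u with s in S_m and u in the tensor power. *)
Definition coinv_ker : {vspace T} :=
  (\sum_(s : 'S_m) limg (linfun (fun u => (tact s u - u)%R)))%VS.

Fact tactB_is_linear s : linear (fun u => tact s u - u).
Proof.
by move=> c u v; rewrite linearP /= scalerBr opprD addrACA.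
Qed.

Lemma tactB_linfun s u : linfun (fun u => tact s u - u) u = tact s u - u.
Proof.
pose L := GRing.isLinear.Build R T T *:%R _ (tactB_is_linear s).
pose g : {linear T -> T} := HB.pack (fun u => tact s u - u) L.
exact: (lfunE g).
Qed.

Lemma coinv_kerP w :
  reflect (exists x : 'S_m -> T, w = \sum_s (tact s (x s) - x s))
          (w \in coinv_ker).
Proof.
apply: (iffP memv_sumP) => [[y yP ->]|[x ->]].
  have {}yP s : exists x, y s == tact s x - x.
    have /memv_imgP[x _ ->] := yP s isT; exists x.
    by rewrite tactB_linfun.
  by exists (fun s => xchoose (yP s)); apply: eq_bigr => s _;
    apply/eqP/(xchooseP (yP s)).
exists (fun s => tact s (x s) - x s) => // s _.
by rewrite -tactB_linfun memv_img ?memvf.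
Qed.

Lemma tactB_coinv_ker s u : tact s u - u \in coinv_ker.
Proof.
rewrite -tactB_linfun; apply: (subvP (sumv_sup s _ (subvv _))) => //.
by rewrite memv_img ?memvf.
Qed.

End Tensors.

(* Sym^m <P[k]>, the space of coinvariants. *)
Definition symP (R : realType) (k m : nat) : Type :=
  Quotient.quot (pred_of_vspace (coinv_ker R k m)).
HB.instance Definition _ (R : realType) (k m : nat) :=
  GRing.Zmodule.copy (symP R k m)
    (Quotient.quot (pred_of_vspace (coinv_ker R k m))).

Section Sym.
Variables (R : realType) (k m : nat).
Local Notation V := (freeP R k).
Local Notation T := (tpow R k m).
Local Notation S := (symP R k m).
Local Notation Q := (Quotient.quot (pred_of_vspace (coinv_ker R k m))).
Implicit Types (u v w : T) (s t : 'S_m) (x y z : S).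

Definition scls u : S := \pi_Q u.
Definition srepr x : T := repr (x : Q).

Lemma sreprK x : scls (srepr x) = x.
Proof. exact: reprK. Qed.

Lemma sclsP u v : reflect (scls u = scls v) (u - v \in coinv_ker R k m).
Proof. by rewrite Quotient.idealrBE; apply: eqP. Qed.

Definition sscale (c : R) x : S := scls (c *: srepr x).

Lemma sscale_cls c u : sscale c (scls u) = scls (c *: u).
Proof.
apply/sclsP; rewrite -scalerBr rpredZ //.
by apply/sclsP; rewrite sreprK.
Qed.

Lemma sclsD u v : scls (u + v) = scls u + scls v.
Proof. by rewrite /scls !piE. Qed.

Fact sscaleA a b x : sscale a (sscale b x) = sscale (a * b) x.
Proof. by rewrite -[x]sreprK !sscale_cls scalerA. Qed.
Fact sscale1 : left_id 1 sscale.
Proof. by move=> x; rewrite -[x]sreprK !sscale_cls scale1r. Qed.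
Fact sscaleDr : right_distributive sscale +%R.
Proof.
by move=> c x y; rewrite -[x]sreprK -[y]sreprK -sclsD !sscale_cls scalerDr sclsD.
Qed.
Fact sscaleDl x : {morph sscale^~ x : a b / a + b}.
Proof. by move=> a b; rewrite -[x]sreprK !sscale_cls scalerDl sclsD. Qed.

HB.instance Definition _ :=
  GRing.Zmodule_isLmodule.Build R S sscaleA sscale1 sscaleDr sscaleDl.

Lemma scls_is_linear : linear scls.
Proof. by move=> c u v; rewrite sclsD -sscale_cls. Qed.
HB.instance Definition _ := GRing.isLinear.Build R T S *:%R scls scls_is_linear.

Lemma scls_act s u : scls (tact s u) = scls u.
Proof. apply/sclsP; exact: tactB_coinv_ker. Qed.

(* {a_1, ..., a_m} *)
Definition smset (a : 'I_m -> V) : S := scls (tens a).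

(* The formula does not depend on the representatives; see scup_cls. *)
Definition scup x y : S :=
  (m`!%:R : R)^-1 *: \sum_(t : 'S_m) scls (tcup (srepr x) (tact t (srepr y))).

Local Notation avg u v :=
  ((m`!%:R : R)^-1 *: \sum_(t : 'S_m) scls (tcup u (tact t v))).

Lemma avgC u v : avg u v = avg v u.
Proof.
congr (_ *: _); rewrite (reindex_inj invg_inj) /=; apply: eq_bigr => s _.
by rewrite -(scls_act s) tact_cup tact_tact mulVg tcupC; congr (scls (tcup _ _));
  apply/ffunP => f; rewrite !ffunE; congr (v _); apply/ffunP => j;
  rewrite !ffunE perm1.
Qed.

Lemma avg_ker u v v' : scls v = scls v' -> avg u v = avg u v'.
Proof.
move/sclsP/coinv_kerP => [x e]; rewrite -[v](subrK v') e; congr (_ *: _).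
pose phi t : {linear T -> S} := scls \o (tcup u \o tact t).
under eq_bigr => t _ do rewrite -[scls _]/(phi t _) linearD linear_sum.
rewrite big_split exchange_big /= big1 => [|s _]; first by rewrite add0r.
under eq_bigr => t _ do rewrite !linearB /= tact_tact.
rewrite sumrB; apply/eqP; rewrite subr_eq0; apply/eqP.
by rewrite [RHS](reindex_inj (mulgI s)).
Qed.

Lemma scup_cls u v :
  scup (scls u) (scls v) =
  (m`!%:R : R)^-1 *: \sum_(t : 'S_m) scls (tcup u (tact t v)).
Proof.
rewrite /scup (@avg_ker _ _ v) ?sreprK // avgC (@avg_ker _ _ u) ?sreprK //.
exact: avgC.
Qed.

(* {0, ..., 0} with 0 the empty set: the neutral element of scup, so that an
   iterated union over a nonempty range does not depend on it. *)
Definition sone : S := smset (fun=> bset R set0).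

Lemma scupC : commutative scup.
Proof. by move=> x y; rewrite -[x]sreprK -[y]sreprK !scup_cls avgC. Qed.

Lemma scupA : associative scup.
Proof.
move=> x y z; rewrite -[x]sreprK -[y]sreprK -[z]sreprK.
move: (srepr x) (srepr y) (srepr z) => {x y z} u v w.
have E u' v' : scup (scls u') (scls v') =
    scls ((m`!%:R : R)^-1 *: \sum_(t : 'S_m) tcup u' (tact t v')).
  by rewrite scup_cls linearZ; congr (_ *: _); rewrite linear_sum.
rewrite (E u) (E v) !scup_cls; congr (_ *: _).
pose phi t : {linear T -> S} := scls \o (tcup u \o tact t).
under eq_bigr => t _ do rewrite -[scls _]/(phi t _) linearZ linear_sum.
pose psi t : {linear T -> S} := scls \o tcup (tact t w).
under [RHS]eq_bigr => t _ do
  rewrite tcupC -[scls _]/(psi t _) linearZ linear_sum.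
rewrite -!scaler_sumr; congr (_ *: _); rewrite [RHS]exchange_big /=.
apply: eq_bigr => t _; rewrite [RHS](reindex_inj (mulIg t)) /=.
apply: eq_bigr => s _; congr scls.
by rewrite tact_cup tact_tact tcupA tcupC.
Qed.

Lemma scup1x : left_id sone scup.
Proof.
move=> x; rewrite scupC -[x]sreprK scup_cls.
rewrite (eq_bigr (fun=> x)) => [|t _].
  rewrite sumr_const card_Sn -scaler_nat scalerA mulVf ?scale1r ?sreprK //.
  by rewrite pnatr_eq0 -lt0n fact_gt0.
rewrite -[RHS]sreprK; congr scls; rewrite tact_tens.
rewrite [in LHS](tpow_decomp (srepr x)) [RHS]tpow_decomp tcup_suml.
apply: eq_bigr => f _; congr (_ *: _); rewrite tcup_tens.
pose g : {ffun 'I_m -> {set 'I_k}} := [ffun=> set0].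
have -> : tbas R f = tcup (tbas R f) (tbas R g).
  by rewrite tcup_bas; congr tbas; apply/ffunP => j; rewrite !ffunE setU0.
by rewrite tcup_tens; apply: tens_eq => j; rewrite ffunE.
Qed.

HB.instance Definition _ := Monoid.isComLaw.Build S sone scup scupA scupC scup1x.

Section Power.
Variables (mu : {set 'I_k} -> R) (l : nat).

Definition tpower u : R :=
  \sum_(f : {ffun 'I_m -> {set 'I_k}}) u f * \sum_j mu (f j) ^+ l.

(* Linear, independent of the representative, and determined by its values on
   the {a_1, ..., a_m}; see spower_cls and spower_smset. *)
Definition spower x : R := tpower (srepr x).

Lemma tpower_is_linear : scalar tpower.
Proof.
move=> c u v; rewrite /tpower mulr_sumr -big_split /=; apply: eq_bigr => f _.
by rewrite !ffunE mulrDl mulrA.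
Qed.
HB.instance Definition _ := GRing.isLinear.Build R T R *%R tpower tpower_is_linear.

Lemma tpower_act s u : tpower (tact s u) = tpower u.
Proof.
rewrite /tpower [RHS](reindex_onto (fun f : {ffun 'I_m -> {set 'I_k}} =>
  [ffun j => f (s j)]) (fun f => [ffun j => f (s^-1%g j)])) /=; last first.
  by move=> f _; apply/ffunP => j; rewrite !ffunE permK.
apply: eq_big => [f|f _].
  by rewrite (_ : _ == _); last by apply/eqP/ffunP => j; rewrite !ffunE permKV.
rewrite ffunE; congr (_ * _); rewrite (reindex_inj (@perm_inj _ s)) /=.
by apply: eq_bigr => j _; rewrite ffunE.
Qed.

Lemma spower_cls u : spower (scls u) = tpower u.
Proof.
have /coinv_kerP[x e] : srepr (scls u) - u \in coinv_ker R k m.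
  by apply/sclsP; rewrite sreprK.
rewrite /spower -[srepr _](subrK u) e linearD linear_sum /= big1 ?add0r // => s _.
by rewrite linearB /= tpower_act subrr.
Qed.

Lemma spower_is_linear : scalar spower.
Proof.
move=> c x y; rewrite -[x]sreprK -[y]sreprK -linearZ -linearD /=.
by rewrite !spower_cls linearP.
Qed.
HB.instance Definition _ := GRing.isLinear.Build R S R *%R spower spower_is_linear.

Lemma spower_smset (a : 'I_m -> {set 'I_k}) :
  spower (smset (fun j => bset R (a j))) = \sum_j mu (a j) ^+ l.
Proof.
rewrite spower_cls /tpower tens_bset (bigD1 (finfun a)) //= [X in _ + X]big1 => [|f nf].
  rewrite [X in X * _]ffunE eqxx mul1r [LHS]addr0.
  by apply: eq_bigr => j _; rewrite ffunE.
by rewrite ffunE (negbTE nf) mul0r.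
Qed.

End Power.
End Sym.

(* Main.v *)
(** The averaged union of classes of pure tensors expands multilinearly: the
    first factor stays fixed and every other one runs through its S_m-orbit, so
    the left-hand side is the average of the numbers
    sum_j mu (a^1_(s_1 j) U ... U a^n_(s_n j)) ^ l.  Inclusion-exclusion turns
    each measure into an alternating sum over nonempty I, and the multinomial
    theorem expands its l-th power. *)
From HB Require Import structures.
Require Import Defs.
From mathcomp Require Import all_boot all_order all_algebra all_fingroup.
From mathcomp Require Import reals ring.
Import GRing.Theory Num.Theory.
Local Open Scope ring_scope.

Lemma fact_neq0 (F : numFieldType) d : d`!%:R != 0 :> F.
Proof. by rewrite pnatr_eq0 -lt0n fact_gt0. Qed.

Section Multinomial.
Variables (R : numFieldType) (I : finType) (x : I -> R) (l : nat).

(* The multinomial theorem is the degree-l coefficient of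
   prod_i exp (x_i t) = exp ((sum_i x_i) t); truncating at degree l keeps the
   exponents in 'I_l.+1. *)
Definition trunc_exp (y : R) : {poly R} := \poly_(c < l.+1) (y ^+ c / c`!%:R).

(** Induction on [r]: one more factor convolves the coefficients, which is the binomial theorem
    divided by [d!]. The bound [d <= l] keeps every coefficient involved within the truncation. *)
Lemma coef_prod_trunc_exp (r : seq I) d : (d <= l)%N ->
  (\prod_(i <- r) trunc_exp (x i))`_d = (\sum_(i <- r) x i) ^+ d / d`!%:R.
Proof.
elim: r d => [|i r IHr] d led.
  rewrite !big_nil coef1 expr0n; case: d led => [|d] _ /=.
    by rewrite fact0 divr1.
  by rewrite mul0r.
rewrite !big_cons coefM addrC exprDn mulr_suml; apply: eq_bigr => -[j /= ltj] _.
have lej : (j <= d)%N by [].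
rewrite coef_poly ltnS (leq_trans lej led) IHr ?(leq_trans (leq_subr _ _)) //.
rewrite -mulr_natr -(bin_fact lej) !natrM.
have bn0 : 'C(d, j)%:R != 0 :> R by rewrite pnatr_eq0 -lt0n bin_gt0.
by field; rewrite bn0 !fact_neq0.
Qed.

Lemma multinomial_theorem :
  (\sum_i x i) ^+ l =
  \sum_(c : {ffun I -> 'I_l.+1} | (\sum_i c i)%N == l)
    l`!%:R / \prod_i (c i)`!%:R * \prod_i x i ^+ c i.
Proof.
have := @coef_prod_trunc_exp (index_enum I) l (leqnn l).
under eq_bigr do rewrite /trunc_exp poly_def.
rewrite bigA_distr_bigA /= coef_sum => /(congr1 ( *%R^~ l`!%:R)).
rewrite divfK ?fact_neq0 // => <-.
rewrite mulr_suml [RHS]big_mkcond; apply: eq_bigr => c _.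
(* Each family [c] contributes a single monomial, of degree the sum of [c], so the coefficient at
   [l] retains the families of total [l]. *)
rewrite scaler_prod -(big_morph _ (exprD 'X) (expr0 'X)) coefZ coefXn eq_sym.
case: eqP => _; last by rewrite mulr0 mul0r.
by rewrite mulr1 big_split prodfV /=; ring.
Qed.

End Multinomial.

Section InclusionExclusion.
Variables (R : realType) (k : nat) (mu : {set 'I_k} -> R).
Hypothesis mu_measure : is_measure mu.

Lemma measure_set0 : mu set0 = 0.
Proof.
have : mu (set0 :|: set0) = mu set0 + mu set0.
  by apply: mu_measure; rewrite -setI_eq0 setI0.
by rewrite setU0 => e; apply: (addrI (mu set0)); rewrite addr0.
Qed.

(** Additivity strips one point at a time. Point masses reduce inclusion-exclusion to an identity
    between indicators. *)
Lemma measure_sum (A : {set 'I_k}) : mu A = \sum_x (x \in A)%:R * mu [set x].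
Proof.
elim: {A}#|A| {-2}A (erefl #|A|) => [|d IHd] A cardA.
  have -> : A = set0 by exact: cards0_eq.
  by rewrite measure_set0 big1 // => x _; rewrite inE mul0r.
have /card_gt0P[y yA] : (0 < #|A|)%N by rewrite cardA.
rewrite -(setD1K yA) mu_measure; last by rewrite disjoints1 !inE eqxx.
rewrite (IHd (A :\ y)); last by move: cardA; rewrite (cardsD1 y A) yA => -[].
rewrite (bigD1 y) //= [RHS](bigD1 y) //= !inE eqxx /= mul0r mul1r add0r.
congr (_ + _); apply: eq_bigr => x nxy.
by rewrite !inE (negbTE nxy).
Qed.

Lemma measure_bigcup (n : nat) (A : 'I_n -> {set 'I_k}) :
  mu (\bigcup_i A i) =
  \sum_(I : neset n) (-1) ^+ (#|val I| + 1) * mu (\bigcap_(i in val I) A i).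
Proof.
rewrite -(big_sub [pred J | J != set0]
  (fun J : {set 'I_n} => (-1) ^+ (#|J| + 1) * mu (\bigcap_(i in J) A i))) /=.
rewrite measure_sum.
under [RHS]eq_bigr => J _ do rewrite (measure_sum (\bigcap_(i in J) A i)) mulr_sumr.
rewrite exchange_big; apply: eq_bigr => x _ /=.
under [RHS]eq_bigr => J _ do rewrite mulrA.
rewrite -mulr_suml; congr (_ * _).
(* A point misses the union iff it misses every [A i]. Expanding the product over subsets [J] yields
   the signs, and the term [J = set0] cancels the leading 1. *)
have -> : (x \in \bigcup_i A i)%:R = 1 - \prod_i (- (x \in A i)%:R + 1) :> R.
  case: bigcupP => [[i _ xi]|nx].
    by rewrite (bigD1 i) //= xi addNr mul0r subr0.
  rewrite big1 ?subrr // => i _; case: (boolP (x \in A i)) => [xi|_].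
    by case: nx; exists i.
  by rewrite oppr0 add0r.
rewrite bigA_distr (bigD1 set0) //= [X in _ - (X + _)]big1 => [|i _]; last by rewrite inE.
rewrite opprD addNKr -sumrN; apply: eq_bigr => J _.
rewrite -big_mkcond prodrN /= addn1 exprS mulN1r mulNr; congr (- (_ * _)).
case: bigcapP => [xJ|nx]; first by rewrite big1 // => i /xJ ->.
have /existsP[i /andP[iJ nxi]] : [exists i, (i \in J) && (x \notin A i)].
  rewrite -negb_forall_in; apply/negP => /forall_inP xJ; exact: nx.
by rewrite (bigD1 i) //= (negbTE nxi) mul0r.
Qed.

End InclusionExclusion.

Section IteratedUnion.
Variables (R : realType) (k m : nat).
Local Notation T := (tpow R k m).
Local Notation tcup := (@tcup R k m).

Definition tone : T := tbas R [ffun=> set0].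

Lemma tcup1u : left_id tone tcup.
Proof.
move=> u; rewrite [u in LHS]tpow_decomp tcup_sumr [RHS]tpow_decomp.
apply: eq_bigr => f _; rewrite tcup_bas; congr (_ *: tbas _ _).
by apply/ffunP => j; rewrite !ffunE set0U.
Qed.

Lemma tcup0u : left_zero 0 tcup.
Proof.
(* Linearity is registered in the second argument only, so 0 is moved there and [tcup u] is refolded
   into its linear map. *)
by move=> u; rewrite tcupC -[Defs.tcup u]/(GRing.Linear.sort _) linear0.
Qed.

Lemma tcupu0 : right_zero 0 tcup.
Proof. by move=> u; rewrite tcupC tcup0u. Qed.

Lemma tcupDr : right_distributive tcup +%R.
Proof. by move=> u v w; rewrite linearD. Qed.

Lemma tcupDl : left_distributive tcup +%R.
Proof. by move=> u v w; rewrite tcupC tcupDr !(tcupC w). Qed.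

HB.instance Definition _ :=
  Monoid.isComLaw.Build T tone tcup (@tcupA R k m) (@tcupC R k m) tcup1u.
HB.instance Definition _ := Monoid.isMulLaw.Build T 0 tcup tcup0u tcupu0.

(** Generality in [u] lets the induction absorb each [v i] into the left factor; each absorption
    averages over ['S_m] and costs one division by [m!]. *)
Lemma scup_big_scls (I : Type) (r : seq I) (P : pred I) (v : I -> T) (u : T) :
  scup (scls u) (\big[@scup R k m/sone R k m]_(i <- r | P i) scls (v i)) =
  (m`!%:R ^+ count P r)^-1 *:
    scls (tcup u (\big[tcup/tone]_(i <- r | P i) \sum_t tact t (v i))).
Proof.
elim: r u => [|i r IHr] u.
  by rewrite !big_nil /= invr1 scale1r scupC scup1x tcupC tcup1u.
rewrite !big_cons /=; case: ifP => _ //=.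
rewrite scupA.
have -> : scup (scls u) (scls (v i)) =
    scls ((m`!%:R : R)^-1 *: tcup u (\sum_t tact t (v i))).
  by rewrite scup_cls linearZ; congr (_ *: _); rewrite [tcup u _]linear_sum linear_sum.
rewrite IHr tcupC linearZ /= tcupC -tcupA linearZ /= scalerA; congr (_ *: _).
by rewrite exprS invfM mulrC.
Qed.

Lemma big_tcup_tbas (I : finType) (f : I -> {ffun 'I_m -> {set 'I_k}}) :
  \big[tcup/tone]_i tbas R (f i) = tbas R [ffun j => \bigcup_i f i j].
Proof.
suff E (r : seq I) : \big[tcup/tone]_(i <- r) tbas R (f i) =
    tbas R [ffun j => \bigcup_(i <- r) f i j] by exact: E.
elim: r => [|i r IHr].
  by rewrite big_nil; congr tbas; apply/ffunP => j; rewrite !ffunE big_nil.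
rewrite big_cons IHr tcup_bas; congr tbas.
by apply/ffunP => j; rewrite !ffunE big_cons.
Qed.

Lemma big_scup_smset (I : finType) (i0 : I) (a : I -> 'I_m -> {set 'I_k}) :
  \big[@scup R k m/sone R k m]_i smset (fun j => bset R (a i j)) =
  (m`!%:R ^+ (#|I| - 1))^-1 *:
    \sum_(sigma : {ffun I -> 'S_m} | sigma i0 == 1%g)
      smset (fun j => bset R (\bigcup_i a i (sigma i j))).
Proof.
have smsetE (b : 'I_m -> {set 'I_k}) :
    smset (fun j => bset R (b j)) = scls (tbas R (finfun b)).
  by congr scls; apply: tens_eq => j; rewrite ffunE.
under eq_bigr do rewrite smsetE.
rewrite (bigD1 i0) //= scup_big_scls -size_filter.
(* Only the indices other than [i0] are averaged, hence the exponent. *)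
have -> : size [seq i <- index_enum I | i != i0] = (#|I| - 1)%N.
  by rewrite subn1 -(cardC1 i0) cardE /enum_mem; congr size; rewrite unlock.
congr (_ *: _).
(* [Q] states [sigma i0 = 1] index by index, so that every factor becomes a sum over permutations
   and distributivity yields exactly the admissible [sigma]. *)
pose Q (i : I) : pred 'S_m := fun t => (i == i0) ==> (t == 1%g).
pose u i := tbas R (finfun (a i)).
(* Summing over inverses offsets the inverse in [tact_bas], so that position [j] receives
   [a i (sigma i j)]. *)
have -> : tcup (u i0) (\big[tcup/tone]_(i | i != i0) \sum_t tact t (u i)) =
    \big[tcup/tone]_i \sum_(t | Q i t) tact t^-1%g (u i).
  rewrite [RHS](bigD1 i0) //=; congr (tcup _ _).
    rewrite (big_pred1 1%g) => [|t]; last by rewrite /Q eqxx.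
    by rewrite tact_bas; congr tbas; apply/ffunP => j; rewrite !ffunE invgK perm1.
  apply: eq_bigr => i ni; rewrite (reindex_inj invg_inj) /=.
  by apply: eq_bigl => t; rewrite /Q (negbTE ni).
(* Packed by hand: canonical inference on +%R would only find the law
   distributing over ring multiplication. *)
pose tadd : Monoid.add_law 0 tcup :=
  HB.pack (+%R : T -> T -> T)
    (Monoid.isComLaw.Build T 0 +%R (@addrA T) (@addrC T) (@add0r T))
    (Monoid.isAddLaw.Build T tcup +%R tcupDl tcupDr).
rewrite (bigA_distr_big_dep (plus := tadd)) [LHS]linear_sum /=.
apply: eq_big => [sigma|sigma _].
  apply/familyP/eqP => [/(_ i0)|s1 i]; first by rewrite /Q unfold_in eqxx => /eqP.
  by rewrite unfold_in; apply/implyP => /eqP ->; rewrite s1.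
rewrite smsetE; congr scls; under eq_bigr do rewrite tact_bas.
rewrite big_tcup_tbas; congr tbas; apply/ffunP => j; rewrite !ffunE.
by apply: eq_bigr => i _; rewrite !ffunE invgK.
Qed.

End IteratedUnion.

Theorem theorem4p4 (R : realType) (k m n l : nat)
  (hk : (0 < k)%N) (hm : (0 < m)%N) (hn : (0 < n)%N) (hl : (0 < l)%N)
  (mu : {set 'I_k} -> R) (hmu : is_measure mu)
  (a : 'I_n -> 'I_m -> {set 'I_k}) :
  spower mu l
    (\big[@scup R k m / sone R k m]_(i < n) smset (fun j => bset R (a i j))) =
  (m`!%:R ^+ (n - 1))^-1 *
  \sum_(sigma : {ffun 'I_n -> 'S_m} | sigma (Ordinal hn) == 1%g)
    \sum_(j < m)
      \sum_(c : {ffun neset n -> 'I_l.+1} | (\sum_(I : neset n) c I)%N == l)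
        (l`!%:R / \prod_(I : neset n) (c I)`!%:R) *
        \prod_(I : neset n) ((-1) ^+ ((#|val I| + 1) * c I) *
                 mu (\bigcap_(i in val I) a i (sigma i j)) ^+ c I).
Proof.
rewrite (@big_scup_smset R k m _ (Ordinal hn)) card_ord linearZ /=.
rewrite linear_sum; congr (_ * _); apply: eq_bigr => sigma _.
rewrite [LHS]spower_smset; apply: eq_bigr => j _.
(* The multinomial variables are the signed terms of inclusion-exclusion, one for each nonempty
   [I]. *)
rewrite (@measure_bigcup R k mu hmu) multinomial_theorem; apply: eq_bigr => c _.
congr (_ * _); apply: eq_bigr => I _.
by rewrite exprMn exprM.
Qed.
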